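(* Let $G=(V,E)$ be a finite graph, let $\mathcal{S}=\{S_i\}_{i\in V}$ be a scale on $G$, and let $\overline{\mathcal{S}}=\{\overline{S}_i\}_{i\in V}$ be its dual scale. Then the pseudo-flow problem (D) at scale $\overline{\mathcal{S}}$ is dual (as a linear program) to the probability-measure problem (P) at scale $\mathcal{S}$. In particular, for each admissible solution $(x,(e_{ij,k}),e)$ of (P) and each admissible solution $(\eta,\kappa,\varphi)$ of (D), $$\sum_{i\in V}\eta_i\le e,$$ and the optimal values of (P) and (D) are equal.
   Context: A graph $G=(V,E)$ is oriented, with $E\subset V\times V$ and no self-loops; $ij\in E$ denotes an edge with initial vertex $i$ and terminal vertex $j$. A scale on $G$ is a family $\mathcal{S}=\{S_i\}_{i\in V}$ of subsets of $V$; its dual scale is $\overline{\mathcal{S}}=\{\overline{S}_i\}_{i\in V}$ with $\overline{S}_i=\{j\in V: i\in S_j\}$. (P) (minimal variation of probability measures at scale $\mathcal{S}$): minimize $e$ subject to - $\sum_{j\in V}x_{i,j}=1$ for each $i\in V$; - $x_{i,j}=0$ for each $i\in V$, $j\in V\setminus S_i$; - $x_{j,k}-x_{i,k}\le e_{ij,k}$ and $x_{i,k}-x_{j,k}\le e_{ij,k}$ for each $ij\in E$, $k\in V$; - $\sum_{k\in V}e_{ij,k}\le e$ for each $ij\in E$; - $x_{i,j},e_{ij,k},e\ge 0$. (D) (maximal net supply of pseudo-flows at dual scale $\overline{\mathcal{S}}$): maximize $\sum_{i\in V}\eta_i$ subject to - $\sum_{ij\in E}\kappa_{ij}\le 1$;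 - $-\kappa_{ij}\le\varphi_{k,ij}\le\kappa_{ij}$ for each $ij\in E$, $k\in V$; - $\sum_{m\in V,\,mi\in E}\varphi_{k,mi}-\sum_{m\in V,\,im\in E}\varphi_{k,im}\ge\eta_i$ for each $k\in V$, $i\in\overline{S}_k$; - $\eta_i,\varphi_{k,ij}\in\mathbb{R}$, $\kappa_{ij}\ge 0$. Admissible means satisfying all constraints. Usual conventions: the infimum of an infeasible minimization problem is $+\infty$, and the value of an unbounded maximization problem is $+\infty$. ''Dual'' means that (D) is the standard linear-programming dual of (P) after eliminating/substituting auxiliary variables. *)

(* Defs.v *)
From HB Require Import structures.
From mathcomp Require Import all_boot all_order all_algebra.
From mathcomp Require Import classical_sets reals constructive_ereal ereal.

Set Implicit Arguments.
Unset Strict Implicit.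
Unset Printing Implicit Defensive.

Import Order.TTheory GRing.Theory Num.Theory.
Local Open Scope ring_scope.

(* The linear program  minimize \sum_v obj v * x v  subject to, for each row r,
   \sum_v mx r v * x v = rhs r  if  eqrow r  and  >= rhs r  otherwise;
   the variable v is unrestricted if  free v  and nonnegative otherwise. *)
Record lp (R : numDomainType) := LP {
  lp_var : finType;
  lp_row : finType;
  lp_free : pred lp_var;
  lp_eqrow : pred lp_row;
  lp_mx : lp_row -> lp_var -> R;
  lp_rhs : lp_row -> R;
  lp_obj : lp_var -> R
}.

Definition lp_feasible (R : numDomainType) (L : lp R) (x : lp_var L -> R) : Prop :=
  (forall v, ~~ lp_free v -> 0 <= x v) /\
  (forall r, if lp_eqrow r then \sum_v lp_mx r v * x v = lp_rhs r
             else lp_rhs r <= \sum_v lp_mx r v * x v).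

Definition lp_value (R : numDomainType) (L : lp R) (x : lp_var L -> R) : R :=
  \sum_v lp_obj v * x v.

(* The standard dual: maximize \sum_r rhs r * y r, with a multiplier y r >= 0 for
   each inequality row and an unrestricted one for each equality row. *)
Definition lp_dual_feasible (R : numDomainType) (L : lp R)
    (y : lp_row L -> R) : Prop :=
  (forall r, ~~ lp_eqrow r -> 0 <= y r) /\
  (forall v, if lp_free v then \sum_r lp_mx r v * y r = lp_obj v
             else \sum_r lp_mx r v * y r <= lp_obj v).

Definition lp_dual_value (R : numDomainType) (L : lp R) (y : lp_row L -> R) : R :=
  \sum_r lp_rhs r * y r.

Arguments lp_feasible {R} L x.
Arguments lp_value {R} L x.
Arguments lp_dual_feasible {R} L y.
Arguments lp_dual_value {R} L y.

Definition edge (V : finType) (E : {set V * V}) := {ij : V * V | ij \in E}.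

Definition esrc (V : finType) (E : {set V * V}) (a : edge E) : V := (val a).1.
Definition etgt (V : finType) (E : {set V * V}) (a : edge E) : V := (val a).2.

Definition dual_scale (V : finType) (S : V -> {set V}) (i : V) : {set V} :=
  [set j | i \in S j]%SET.

(* Problem (P); [ee a k] is e_{ij,k} for the edge a = ij. *)
Definition P_admissible (R : numDomainType) (V : finType) (E : {set V * V})
    (S : V -> {set V}) (x : V -> V -> R) (ee : edge E -> V -> R) (e : R) : Prop :=
  [/\ forall i, \sum_j x i j = 1,
      forall i j, j \notin S i -> x i j = 0,
      forall a k, x (etgt a) k - x (esrc a) k <= ee a k /\
                  x (esrc a) k - x (etgt a) k <= ee a k,
      forall a, \sum_k ee a k <= e &
      [/\ forall i j, 0 <= x i j, forall a k, 0 <= ee a k & 0 <= e]].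

(* Problem (D) at scale [T]; [phi k a] is varphi_{k,ij} for the edge a = ij. *)
Definition D_admissible (R : numDomainType) (V : finType) (E : {set V * V})
    (T : V -> {set V}) (eta : V -> R) (kappa : edge E -> R)
    (phi : V -> edge E -> R) : Prop :=
  [/\ \sum_a kappa a <= 1,
      forall k a, - kappa a <= phi k a /\ phi k a <= kappa a,
      forall k i, i \in T k ->
        \sum_(a | etgt a == i) phi k a - \sum_(a | esrc a == i) phi k a >= eta i &
      forall a, 0 <= kappa a].

Definition P_value (R : realType) (V : finType) (E : {set V * V})
    (S : V -> {set V}) : \bar R :=
  ereal_inf [set v : \bar R | exists (x : V -> V -> R) (ee : edge E -> V -> R)
    (e : R), P_admissible S x ee e /\ v = e%:E]%classic.

Definition D_value (R : realType) (V : finType) (E : {set V * V})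
    (T : V -> {set V}) : \bar R :=
  ereal_sup [set v : \bar R | exists (eta : V -> R) (kappa : edge E -> R)
    (phi : V -> edge E -> R),
    D_admissible T eta kappa phi /\ v = (\sum_i eta i)%:E]%classic.

(* The variables of (P), in order: x_{i,j}; e_{ij,k}; e. *)
Definition P_var (V : finType) (E : {set V * V}) : finType :=
  (V * V + edge E * V + unit)%type.

Definition off_scale (V : finType) (S : V -> {set V}) :=
  {ij : V * V | ij.2 \notin S ij.1}.

(* The rows of (P), in order: \sum_j x_{i,j} = 1; x_{i,j} = 0 off the scale;
   e_{ij,k} - x_{j,k} + x_{i,k} >= 0; e_{ij,k} - x_{i,k} + x_{j,k} >= 0;
   e - \sum_k e_{ij,k} >= 0. *)
Definition P_row (V : finType) (E : {set V * V}) (S : V -> {set V}) : finType :=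
  (V + off_scale S + edge E * V + edge E * V + edge E)%type.

Definition P_eqrow (V : finType) (E : {set V * V}) (S : V -> {set V})
    (r : P_row E S) : bool :=
  match r with
  | inl (inl (inl _)) => true
  | _ => false
  end.

Definition P_rhs (R : numDomainType) (V : finType) (E : {set V * V})
    (S : V -> {set V}) (r : P_row E S) : R :=
  match r with
  | inl (inl (inl (inl _))) => 1
  | _ => 0
  end.

Definition P_obj (R : numDomainType) (V : finType) (E : {set V * V})
    (v : P_var E) : R :=
  match v with
  | inr tt => 1
  | _ => 0
  end.

Definition P_mx (R : numDomainType) (V : finType) (E : {set V * V})
    (S : V -> {set V}) (r : P_row E S) (v : P_var E) : R :=
  match r, v with
  | inl (inl (inl (inl i))), inl (inl ij) => (ij.1 == i)%:R
  | inl (inl (inl (inr p))), inl (inl ij) => (ij == val p)%:R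
  | inl (inl (inr ak)), inl (inl ij) =>
      (ij == (esrc ak.1, ak.2))%:R - (ij == (etgt ak.1, ak.2))%:R
  | inl (inl (inr ak)), inl (inr bk) => (bk == ak)%:R
  | inl (inr ak), inl (inl ij) =>
      (ij == (etgt ak.1, ak.2))%:R - (ij == (esrc ak.1, ak.2))%:R
  | inl (inr ak), inl (inr bk) => (bk == ak)%:R
  | inr a, inl (inr bk) => - (bk.1 == a)%:R
  | inr _, inr tt => 1
  | _, _ => 0
  end.

Definition P_lp (R : numDomainType) (V : finType) (E : {set V * V})
    (S : V -> {set V}) : lp R :=
  @LP R (P_var E) (P_row E S) xpred0 (@P_eqrow V E S)
    (@P_mx R V E S) (@P_rhs R V E S) (@P_obj R V E).

Definition P_vec (R : numDomainType) (V : finType) (E : {set V * V})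
    (S : V -> {set V}) (x : V -> V -> R) (ee : edge E -> V -> R) (e : R) :
    lp_var (P_lp R E S) -> R :=
  fun v : P_var E => match v with
  | inl (inl ij) => x ij.1 ij.2
  | inl (inr ak) => ee ak.1 ak.2
  | inr tt => e
  end.

(* Every vector of dual multipliers of [P_lp] is of this form. *)
Definition P_mult (R : numDomainType) (V : finType) (E : {set V * V})
    (S : V -> {set V}) (eta : V -> R) (mu : off_scale S -> R)
    (phip phim : V -> edge E -> R) (kappa : edge E -> R) :
    lp_row (P_lp R E S) -> R :=
  fun r : P_row E S => match r with
  | inl (inl (inl (inl i))) => eta i
  | inl (inl (inl (inr p))) => mu p
  | inl (inl (inr ak)) => phip ak.2 ak.1
  | inl (inr ak) => phim ak.2 ak.1
  | inr a => kappa a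
  end.

(* Main.v *)
Require Import Defs.
From HB Require Import structures.
From mathcomp Require Import all_boot all_order all_algebra.
From mathcomp Require Import boolp classical_sets reals constructive_ereal ereal.
From mathcomp Require Import ring lra.

Set Implicit Arguments.
Unset Strict Implicit.
Unset Printing Implicit Defensive.

Import Order.TTheory GRing.Theory Num.Theory.
Local Open Scope ring_scope.

(** The problem (P) is, up to packing its variables into one vector, the
    program [P_lp]; its dual program has one multiplier per row of (P).  Reading
    off the columns of the matrix gives the constraints of that dual.  The
    column of [e] gives [\sum_a kappa a <= 1].  The column of [e_{a,k}] gives
    [phip k a + phim k a <= kappa a], where [phip] and [phim] are the multipliers
    of the two halves of [|x_{j,k} - x_{i,k}| <= e_{ij,k}]; together with
    nonnegativity this says exactly that [phi := phip - phim] can be chosen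
    freely in [[- kappa a, kappa a]].  The column of [x_{i,j}] says that the net
    inflow of [phi j] at [i] is at least [eta i] plus the multiplier of the row
    [x_{i,j} = 0], when that row exists.  This last multiplier has no sign and
    occurs nowhere else, so it makes the constraint vacuous when [j] is not in
    [S i]: only the constraints with [i] in the dual scale of [j] survive, and
    (D) is what is left ([D_admissibleP]).

    It remains to prove linear-programming duality.  Weak duality
    ([lp_weak_duality]) is the exchange of a double sum.  Strong duality
    ([lp_strong_duality]) comes from Farkas' lemma applied to the homogenised
    program: if [z] bounds the objective from below on a nonempty feasible set,
    then [\sum_v obj v * x v - z * t] is nonnegative on the cone of all [(x, t)]
    such that [t >= 0] and [x] satisfies the constraints with right-hand side
    scaled by [t]; writing it as a nonnegative combination of the constraints
    yields a dual solution of value at least [z].  Farkas' lemma itself is proved by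
    induction on the number of inequalities ([farkas_ord], an argument of
    D. Bartl), over any vector space and any ordered field.

    For the optimal values, (P) is bounded below by [0], and is feasible exactly
    when every [S i] is nonempty: choose Dirac measures.  In that case strong
    duality applies with [z] the infimum of (P).  If some [S i] is empty, then
    (P) is infeasible, nothing constrains [eta i] in (D), and both values are
    [+oo]. *)

(** * Farkas' lemma *)

(** Induction on the number of inequalities.  If the inequalities other than
    [a ord0] do not already imply [0 <= g], some [x0] satisfies them all with
    [g x0 < 0], and then [a ord0 x0 < 0].  Projecting along [x0] onto the kernel
    of [a ord0] turns the other inequalities and [g] into forms to which the
    induction hypothesis applies.  Undoing the projection only adds a multiple
    of [a ord0], whose coefficient is nonnegative by the choice of [x0]. *)
Lemma farkas_ord (R : realFieldType) (W : lmodType R) (m : nat)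
    (a : 'I_m -> W -> R) (g : W -> R) :
  (forall i, scalar (a i)) -> scalar g ->
  (forall x, (forall i, 0 <= a i x) -> 0 <= g x) ->
  exists2 u : 'I_m -> R, (forall i, 0 <= u i) &
    forall x, g x = \sum_i u i * a i x.
Proof.
elim: m a g => [|m IHm] a g lin_a lin_g a_g.
  exists (fun=> 0) => // x; rewrite big_ord0.
  (* No inequality at all: [g] is nonnegative at both [x] and [- x]. *)
  have gN : g (- x) = - g x.
    have := lin_g (-2) x x; rewrite scaleNr scaler_nat mulr2n opprD addrNK.
    by move=> ->; lra.
  have := a_g x; have := a_g (- x); rewrite gN oppr_ge0 => gx_le0 gx_ge0.
  by apply/le_anti; rewrite gx_le0 ?gx_ge0 //; case.
have [a'_g | /existsNP[x0 /not_implyP[a'x0 /negP]]] :=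
  pselect (forall x, (forall i : 'I_m, 0 <= a (lift ord0 i) x) -> 0 <= g x).
  have [u u_ge0 gE] := IHm _ _ (fun i => lin_a (lift ord0 i)) lin_g a'_g.
  exists (fun i => if unlift ord0 i is Some j then u j else 0) => [i | x].
    by case: unliftP.
  rewrite big_ord_recl unlift_none mul0r add0r gE.
  by apply: eq_bigr => i _; rewrite liftK.
rewrite -ltNge => gx0_lt0.
have ax0_lt0 : a ord0 x0 < 0.
  rewrite ltNge; apply/negP => ax0_ge0.
  suff: 0 <= g x0 by rewrite leNgt gx0_lt0.
  by apply: a_g => i; case: (unliftP ord0 i) => [j ->|->].
pose d := - a ord0 x0; have d_gt0 : 0 < d by rewrite oppr_gt0.
(* The projection onto the kernel of [a ord0] along [x0]. *)
pose p x := (a ord0 x / d) *: x0 + x.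
have lin_p (f : W -> R) : scalar f -> scalar (f \o p).
  move=> lin_f c x y; rewrite /= /p !lin_f lin_a; ring.
have p_ker x : a ord0 (p x) = 0.
  by rewrite lin_a /d; field; lra.
have [||x a'px_ge0|u u_ge0 gpE] := IHm (fun i => a (lift ord0 i) \o p) (g \o p).
- by move=> i; apply: lin_p.
- exact: lin_p.
- apply: a_g => i.
  by case: (unliftP ord0 i) => [j ->|->]; rewrite ?p_ker //; apply: a'px_ge0.
(* The coefficient of [a ord0 x] once [g (p x) = \sum_i u i * a i (p x)] is
   expanded by linearity of [p]. *)
pose u0 := (\sum_i u i * a (lift ord0 i) x0 - g x0) / d.
exists (fun i => if unlift ord0 i is Some j then u j else u0) => [i | x].
  case: unliftP => // _; apply: divr_ge0; last exact: ltW.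
  rewrite subr_ge0 (le_trans (ltW gx0_lt0)) // sumr_ge0 // => j _.
  exact: mulr_ge0.
rewrite big_ord_recl unlift_none.
have := gpE x; rewrite /= lin_g => /(canRL (addKr _)) ->.
under eq_bigr do rewrite lin_a mulrDr mulrCA.
rewrite big_split /= -mulr_sumr.
under [X in _ = _ + X]eq_bigr do rewrite liftK.
by rewrite addrA; congr (_ + _); rewrite /u0; ring.
Qed.

Lemma farkas (R : realFieldType) (W : lmodType R) (I : finType)
    (a : I -> W -> R) (g : W -> R) :
  (forall i, scalar (a i)) -> scalar g ->
  (forall x, (forall i, 0 <= a i x) -> 0 <= g x) ->
  exists2 u : I -> R, (forall i, 0 <= u i) &
    forall x, g x = \sum_i u i * a i x.
Proof.
move=> lin_a lin_g a_g.
have [//||u u_ge0 gE] := @farkas_ord R W #|I| (a \o enum_val) g _ lin_g.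
- by move=> i; apply: lin_a.
- move=> x ax_ge0; apply: a_g => i.
  by have := ax_ge0 (enum_rank i); rewrite /= enum_rankK.
exists (u \o enum_rank) => [i|x]; first exact: u_ge0.
rewrite gE (reindex (@enum_val I I)) /=; last exact/onW_bij/enum_val_bij.
by apply: eq_bigr => i _; rewrite enum_valK.
Qed.

(** * Duality of linear programs *)

Lemma lp_weak_duality (R : numDomainType) (L : lp R) x y :
  lp_feasible L x -> lp_dual_feasible L y -> lp_dual_value L y <= lp_value L x.
Proof.
move=> [x_ge0 row_x] [y_ge0 col_y].
apply: (@le_trans _ _ (\sum_r \sum_v lp_mx r v * x v * y r)).
  apply: ler_sum => r _; rewrite -mulr_suml.
  have := row_x r; have := y_ge0 r; case: ifP => _ //=; first by move=> _ ->.
  by move=> /(_ isT) ? ?; apply: ler_wpM2r.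
rewrite exchange_big; apply: ler_sum => v _ /=.
under eq_bigr do rewrite mulrAC; rewrite -mulr_suml.
have := col_y v; have := x_ge0 v; case: ifP => _ //=; first by move=> _ ->.
by move=> /(_ isT) ? ?; apply: ler_wpM2r.
Qed.

Lemma sum_delta (R : pzSemiRingType) (I : finType) (i : I) (F : I -> R) :
  \sum_j (j == i)%:R * F j = F i.
Proof.
rewrite (bigD1 i) //= eqxx mul1r big1 ?addr0 // => j /negPf ->.
by rewrite mul0r.
Qed.

Lemma scalar_sum (R : comPzRingType) (W : lmodType R) (I : finType)
    (c : I -> R) (f : I -> W -> R) :
  (forall i, scalar (f i)) -> scalar (fun w => \sum_i c i * f i w).
Proof.
move=> lin_f k w w'; rewrite mulr_sumr -big_split; apply: eq_bigr => i _ /=.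
by rewrite lin_f; ring.
Qed.

(** The linear forms on pairs [(x, t)] that are nonnegative exactly on the cone
    over the feasible set: [t >= 0], the sign constraints on [x], and the rows
    with right-hand side scaled by [t].  An equality row contributes the two
    opposite inequalities; the form [0] stands for the constraints that a free
    variable or the second half of an inequality row does not impose. *)
Definition cone_form (R : realFieldType) (L : lp R)
    (j : unit + lp_var L + lp_row L + lp_row L)
    (w : {ffun lp_var L -> R^o} * R^o) : R :=
  match j with
  | inl (inl (inl _)) => w.2
  | inl (inl (inr v)) => if lp_free v then 0 else w.1 v
  | inl (inr r) => \sum_v lp_mx r v * w.1 v - lp_rhs r * w.2
  | inr r =>
    if lp_eqrow r then lp_rhs r * w.2 - \sum_v lp_mx r v * w.1 v else 0
  end.

(** Taking for [z] the infimum of the primal closes the duality gap.  The dual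
    solution consists of the coefficients that Farkas' lemma gives on the cone
    of [cone_form].  Feasibility of [x0] serves for the points at infinity
    [(x, 0)] of the cone: adding a small multiple of [(x0, 1)] moves them to
    points with [t > 0], where [x / t] is feasible. *)
Lemma lp_strong_duality (R : realFieldType) (L : lp R) x0 (z : R) :
  lp_feasible L x0 -> (forall x, lp_feasible L x -> z <= lp_value L x) ->
  exists2 y, lp_dual_feasible L y & z <= lp_dual_value L y.
Proof.
move=> [x0_ge0 row_x0] z_le.
pose W : lmodType R := ({ffun lp_var L -> R^o} * R^o)%type.
have lin_sum (c : lp_var L -> R) : scalar (fun w : W => \sum_v c v * w.1 v).
  by apply: scalar_sum => v k w w'; rewrite !ffunE.
pose g (w : W) := \sum_v lp_obj v * w.1 v - z * w.2.
have lin_g : scalar g.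
  by move=> k w w'; rewrite /g lin_sum /= /GRing.scale /=; ring.
have lin_a (j : unit + lp_var L + lp_row L + lp_row L) :
    scalar (cone_form j : W -> R).
  case: j => [[[[]|v]|r]|r] k w w' /=.
  - by [].
  - by case: ifP => _; rewrite ?ffunE //; ring.
  - by rewrite lin_sum /GRing.scale /=; ring.
  - by case: ifP => _; rewrite ?lin_sum /GRing.scale /=; ring.
have g_ge0 (w : W) : 0 < w.2 -> (forall j, 0 <= cone_form j w) -> 0 <= g w.
  move=> t_gt0 aw_ge0.
  have sumE c : \sum_v c v * (w.1 v / w.2) = (\sum_v c v * w.1 v) / w.2.
    by rewrite mulr_suml; apply: eq_bigr => v _; rewrite mulrA.
  have: z <= lp_value L (fun v => w.1 v / w.2).
    apply: z_le; split=> [v v_signed | r].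
      have := aw_ge0 (inl (inl (inr v))); rewrite /= (negPf v_signed) => ?.
      by rewrite divr_ge0 // ltW.
    rewrite sumE.
    have := aw_ge0 (inl (inr r)); have := aw_ge0 (inr r) => /=.
    case: ifP => _; rewrite !subr_ge0.
      move=> le1 le2.
      have -> : \sum_v lp_mx r v * w.1 v = lp_rhs r * w.2.
        by apply/le_anti; rewrite le1 le2.
      by rewrite mulfK // gt_eqF.
    by move=> _; rewrite ler_pdivlMr.
  by rewrite /lp_value sumE ler_pdivlMr // /g subr_ge0.
pose w0 : W := ([ffun v => x0 v], 1).
have w0E c : \sum_v c v * w0.1 v = \sum_v c v * x0 v.
  by apply: eq_bigr => v _; rewrite ffunE.
have aw0_ge0 j : 0 <= cone_form j w0.
  case: j => [[[[]|v]|r]|r] /=; rewrite ?w0E ?mulr1.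
  - exact: ler01.
  - by case: ifP => // v_signed; rewrite ffunE x0_ge0 ?v_signed.
  - by have := row_x0 r; case: ifP => _ => [->|]; rewrite subr_ge0.
  - by have := row_x0 r; case: ifP => // _ ->; rewrite subrr.
have [//|//|w aw_ge0|u u_ge0 gE] := @farkas R W _ (@cone_form R L) g.
  have gw_ge s : 0 < s -> 0 <= s * g w0 + g w.
    move=> s_gt0; rewrite -lin_g; apply: g_ge0 => [|j].
      rewrite /= ltr_wpDr ?(aw_ge0 (inl (inl (inl tt)))) //.
      by rewrite /GRing.scale /= mulr1.
    by rewrite lin_a addr_ge0 // mulr_ge0 // ltW.
  have gw0_ge0 : 0 <= g w0 by apply: g_ge0 => //; apply: ltr01.
  rewrite leNgt; apply/negP => gw_lt0.
  have d_gt0 : 0 < g w0 + 1 by rewrite ltr_wpDl.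
  (* This multiple of [w0] is too small to compensate [g w < 0]. *)
  have := gw_ge (- g w / (g w0 + 1)); rewrite divr_gt0 ?oppr_gt0 // => /(_ isT).
  suff -> : - g w / (g w0 + 1) * g w0 + g w = g w / (g w0 + 1).
    by rewrite leNgt pmulr_llt0 ?invr_gt0 ?gw_lt0.
  by field; rewrite gt_eqF.
(* The multiplier of an equality row is the difference of the coefficients of
   its two inequalities.  Evaluating [gE] at the basis vectors [(delta v, 0)]
   gives dual feasibility; evaluating it at [(0, 1)] gives the dual value. *)
pose y r := u (inl (inr r)) - (if lp_eqrow r then u (inr r) else 0).
have {}gE w : g w = u (inl (inl (inl tt))) * w.2
    + \sum_v u (inl (inl (inr v))) * (if lp_free v then 0 else w.1 v)
    + \sum_r y r * (\sum_v lp_mx r v * w.1 v - lp_rhs r * w.2).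
  rewrite gE !big_sumType /= (big_pred1 tt) => [|[]//].
  rewrite -addrA -big_split /=; congr (_ + _); apply: eq_bigr => r _.
  by rewrite /y; case: ifP => _; ring.
exists y; first split=> [r /negPf r_ineq | v].
- by rewrite /y r_ineq subr0.
- pose w : W := ([ffun v' => (v' == v)%:R], 0).
  have wE c : \sum_v' c v' * w.1 v' = c v.
    by under eq_bigr do rewrite ffunE mulrC; rewrite sum_delta.
  have := gE w; rewrite /g wE !mulr0 subr0 add0r.
  under [X in _ = _ + X]eq_bigr do rewrite wE mulr0 subr0 mulrC.
  move=> ->; case: ifP => v_free.
    rewrite [X in _ = X + _]big1 ?add0r // => v' _.
    case: ifP => [_|]; rewrite ?mulr0 // ffunE.
    by case: eqP => [->|_]; rewrite ?v_free // mulr0.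
  rewrite lerDr sumr_ge0 // => v' _; rewrite mulr_ge0 //.
  by case: ifP => // _; rewrite ffunE ler0n.
- pose w : W := (0, 1).
  have wE c : \sum_v c v * w.1 v = 0.
    by rewrite big1 // => v _; rewrite ffunE mulr0.
  have := gE w; rewrite /g wE mulr1 sub0r [X in _ + X + _]big1; last first.
    by move=> v _; rewrite ffunE if_same mulr0.
  rewrite mulr1 addr0; under eq_bigr do rewrite wE mulr1 sub0r mulrN mulrC.
  rewrite sumrN => /(congr1 -%R); rewrite opprK => ->.
  by rewrite opprB lerBlDr lerDl.
Qed.

(** * The columns of (P): constraints of the dual program *)

Lemma sum_edge_delta (R : pzSemiRingType) (A V : finType) (end_of : A -> V)
    (i j : V) (F : V -> A -> R) :
  \sum_(ak : A * V) ((i, j) == (end_of ak.1, ak.2))%:R * F ak.2 ak.1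
  = \sum_(a | end_of a == i) F j a.
Proof.
rewrite -(pair_bigA _ (fun a k => ((i, j) == (end_of a, k))%:R * F k a)) /=.
rewrite [RHS]big_mkcond; apply: eq_bigr => a _.
rewrite -[in RHS](sum_delta j (fun k => F k a)) (fun_if (fun c => c)).
case: ifP => ia; last first.
  by rewrite big1 // => k _; rewrite xpair_eqE eq_sym ia mul0r.
by apply: eq_bigr => k _; rewrite xpair_eqE eq_sym ia eq_sym.
Qed.

Section Columns.
Variables (R : realFieldType) (V : finType) (E : {set V * V}).
Variable S : V -> {set V}.
Variables (eta : V -> R) (mu : off_scale S -> R) (phip phim : V -> edge E -> R).
Variable kappa : edge E -> R.

Let y := P_mult eta mu phip phim kappa.

(** The multiplier [mu] of the row [x_{i,j} = 0] enters only off the scale,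
    where that row exists; elsewhere [insub] yields [None] and the term is [0]. *)
Lemma P_col_x i j :
  \sum_(r : P_row E S) P_mx R r (inl (inl (i, j))) * y r
  = eta i + oapp mu 0 (insub (i, j))
    + (\sum_(a | esrc a == i) (phip j a - phim j a)
       - \sum_(a | etgt a == i) (phip j a - phim j a)).
Proof.
rewrite !big_sumType /= [X in _ + X]big1 => [|a _]; last exact: mul0r.
rewrite addr0.
under [X in X + _ + _ + _]eq_bigr do rewrite eq_sym.
rewrite sum_delta -!addrA; congr (_ + _); congr (_ + _).
  case: insubP => [p _ pE | in_scale] /=.
    by rewrite -pE -[RHS](sum_delta p mu); apply: eq_bigr => q _; rewrite eq_sym.
  rewrite big1 // => p _; case: eqP => [ijE | _]; last exact: mul0r.
  by case/negP: in_scale; rewrite ijE; apply: (valP p).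
rewrite !sumrB.
under eq_bigr do rewrite mulrBl.
under [X in _ + X]eq_bigr do rewrite mulrBl.
by rewrite !sumrB !sum_edge_delta; ring.
Qed.

Lemma P_col_ee a k :
  \sum_(r : P_row E S) P_mx R r (inl (inr (a, k))) * y r
  = phip k a + phim k a - kappa a.
Proof.
rewrite !big_sumType /= big1 ?add0r => [|i _]; last exact: mul0r.
rewrite big1 ?add0r => [|p _]; last exact: mul0r.
have sum_ak (F : V -> edge E -> R) :
    \sum_(bl : edge E * V) ((a, k) == bl)%:R * F bl.2 bl.1 = F k a.
  rewrite -[RHS](sum_delta (a, k) (fun bl => F bl.2 bl.1)).
  by apply: eq_bigr => bl _; rewrite eq_sym.
rewrite !sum_ak; congr (_ + _).
by under eq_bigr do rewrite mulNr eq_sym; rewrite sumrN sum_delta.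
Qed.

Lemma P_col_e :
  \sum_(r : P_row E S) P_mx R r (inr tt) * y r = \sum_a kappa a.
Proof.
rewrite !big_sumType /= big1 ?add0r => [|i _]; last exact: mul0r.
do 3!(rewrite big1 ?add0r => [|? _]; last exact: mul0r).
by apply: eq_bigr => a _; rewrite mul1r.
Qed.

Lemma P_lp_dual_value : lp_dual_value (P_lp R E S) y = \sum_i eta i.
Proof.
rewrite /lp_dual_value /= !big_sumType /=.
rewrite [X in _ + X]big1 ?[X in _ + X + _]big1 ?[X in _ + X + _ + _]big1.
rewrite ?[X in _ + X + _ + _ + _]big1.
  by rewrite !addr0; apply: eq_bigr => i _; rewrite mul1r.
all: by move=> ? _; rewrite mul0r.
Qed.

Lemma P_lp_dual_feasibleP :
  lp_dual_feasible (P_lp R E S) y <->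
  [/\ \sum_a kappa a <= 1,
      forall k a, phip k a + phim k a <= kappa a,
      forall i j, eta i + oapp mu 0 (insub (i, j)) <=
        \sum_(a | etgt a == i) (phip j a - phim j a)
        - \sum_(a | esrc a == i) (phip j a - phim j a) &
      [/\ forall k a, 0 <= phip k a, forall k a, 0 <= phim k a
        & forall a, 0 <= kappa a]].
Proof.
split=> [[y_ge0 col_y] | [le1 leK leeta [p_ge0 m_ge0 K_ge0]]].
  split=> [|k a|i j|].
  - by have := col_y (inr tt); rewrite /= P_col_e.
  - by have := col_y (inl (inr (a, k))); rewrite /= P_col_ee subr_le0.
  - have := col_y (inl (inl (i, j))); rewrite /= P_col_x.
    by rewrite -[X in _ + X]opprB subr_le0.
  - split=> [k a|k a|a].
    + exact: (y_ge0 (inl (inl (inr (a, k))))).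
    + exact: (y_ge0 (inl (inr (a, k)))).
    + exact: (y_ge0 (inr a)).
split=> [[[[[i|p]|[a k]]|[a k]]|a] //= _ | [[[i j]|[a k]]|[]] /=].
- by rewrite P_col_x -[X in _ + X]opprB subr_le0.
- by rewrite P_col_ee subr_le0.
- by rewrite P_col_e.
Qed.

End Columns.

(** * The rows of (P) *)

Section Rows.
Variables (R : realFieldType) (V : finType) (E : {set V * V}).
Variable S : V -> {set V}.
Variables (x : V -> V -> R) (ee : edge E -> V -> R) (e : R).

Let X := P_vec (S := S) x ee e.

Lemma P_row_prob i :
  \sum_(v : P_var E) P_mx R (inl (inl (inl (inl i))) : P_row E S) v * X v
  = \sum_j x i j.
Proof.
rewrite !big_sumType /= [X in _ + X]big1 => [|? _]; last exact: mul0r.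
rewrite [X in _ + X + _]big1 => [|? _]; last exact: mul0r.
rewrite !addr0 -(pair_bigA _ (fun i' j => (i' == i)%:R * x i' j)) /=.
under eq_bigr do rewrite -mulr_sumr.
exact: sum_delta.
Qed.

Lemma P_row_off p :
  \sum_(v : P_var E) P_mx R (inl (inl (inl (inr p))) : P_row E S) v * X v
  = x (val p).1 (val p).2.
Proof.
rewrite !big_sumType /= [X in _ + X]big1 => [|? _]; last exact: mul0r.
rewrite [X in _ + X + _]big1 => [|? _]; last exact: mul0r.
by rewrite !addr0 (sum_delta (val p) (fun ij => x ij.1 ij.2)).
Qed.

Lemma P_row_src a k :
  \sum_(v : P_var E) P_mx R (inl (inl (inr (a, k))) : P_row E S) v * X v
  = ee a k - (x (etgt a) k - x (esrc a) k).
Proof.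
rewrite !big_sumType /= [X in _ + X]big1 => [|? _]; last exact: mul0r.
rewrite (sum_delta (a, k) (fun bl => ee bl.1 bl.2)) addr0.
under eq_bigr do rewrite mulrBl.
rewrite sumrB !(sum_delta (_, _) (fun ij => x ij.1 ij.2)) /=; ring.
Qed.

Lemma P_row_tgt a k :
  \sum_(v : P_var E) P_mx R (inl (inr (a, k)) : P_row E S) v * X v
  = ee a k - (x (esrc a) k - x (etgt a) k).
Proof.
rewrite !big_sumType /= [X in _ + X]big1 => [|? _]; last exact: mul0r.
rewrite (sum_delta (a, k) (fun bl => ee bl.1 bl.2)) addr0.
under eq_bigr do rewrite mulrBl.
rewrite sumrB !(sum_delta (_, _) (fun ij => x ij.1 ij.2)) /=; ring.
Qed.

Lemma P_row_edge a :
  \sum_(v : P_var E) P_mx R (inr a : P_row E S) v * X v = e - \sum_k ee a k.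
Proof.
rewrite !big_sumType /= big1 => [|? _]; last exact: mul0r.
rewrite (big_pred1 tt) => [|[]//] /=.
rewrite mul1r add0r addrC; congr (_ + _).
rewrite -(pair_bigA _ (fun b k => - (b == a)%:R * ee b k)) /=.
under eq_bigr do rewrite -mulr_sumr mulNr.
by rewrite sumrN sum_delta.
Qed.

Lemma P_lp_value : lp_value (P_lp R E S) X = e.
Proof.
rewrite /lp_value /= !big_sumType /=.
do 2!(rewrite big1 ?add0r => [|? _]; last exact: mul0r).
by rewrite (big_pred1 tt) => [|[]//]; apply: mul1r.
Qed.

Lemma P_admissibleP :
  P_admissible S x ee e <-> lp_feasible (P_lp R E S) X.
Proof.
split=> [[prob off var le_e [x_ge0 ee_ge0 e_ge0]] | [X_ge0 row_X]].
  split=> [[[[i j]|[a k]]|[]] //= _ | [[[[i|p]|[a k]]|[a k]]|a] /=].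
  - by rewrite P_row_prob.
  - by rewrite P_row_off off ?(valP p).
  - by rewrite P_row_src subr_ge0; case: (var a k).
  - by rewrite P_row_tgt subr_ge0; case: (var a k).
  - by rewrite P_row_edge subr_ge0.
split=> [i|i j ij_off|a k|a|].
- by have := row_X (inl (inl (inl (inl i)))); rewrite /= P_row_prob.
- pose p : off_scale S := Sub (i, j) ij_off.
  exact: etrans (esym (P_row_off p)) (row_X (inl (inl (inl (inr p))))).
- have := row_X (inl (inr (a, k))); have := row_X (inl (inl (inr (a, k)))).
  by rewrite /= P_row_src P_row_tgt !subr_ge0.
- by have := row_X (inr a); rewrite /= P_row_edge subr_ge0.
- split=> [i j|a k|].
  + exact: (X_ge0 (inl (inl (i, j)))).
  + exact: (X_ge0 (inl (inr (a, k)))).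
  + exact: (X_ge0 (inr tt)).
Qed.

End Rows.

(** * Duality between (P) and (D) *)

Section Duality.
Variables (R : realFieldType) (V : finType) (E : {set V * V}).
Variable S : V -> {set V}.

Lemma P_vec_surj (X : lp_var (P_lp R E S) -> R) :
  exists x ee e, X = P_vec x ee e.
Proof.
exists (fun i j => X (inl (inl (i, j)))), (fun a k => X (inl (inr (a, k)))).
by exists (X (inr tt)); apply/funext => -[[[i j]|[a k]]|[]].
Qed.

Lemma P_mult_surj (y : lp_row (P_lp R E S) -> R) :
  exists eta mu phip phim kappa, y = P_mult eta mu phip phim kappa.
Proof.
exists (fun i => y (inl (inl (inl (inl i))))).
exists (fun p => y (inl (inl (inl (inr p))))).
exists (fun k a => y (inl (inl (inr (a, k))))), (fun k a => y (inl (inr (a, k)))).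
exists (fun a => y (inr a)).
by apply/funext => -[[[[i|p]|[a k]]|[a k]]|a].
Qed.

(** From (D) to the dual program: split [phi] into positive and negative parts,
    so that [phip + phim = |phi|], and let [mu] absorb the slack of the flow
    constraint off the scale, where its sign is free. *)
Lemma D_admissibleP (eta : V -> R) (kappa : edge E -> R) (phi : V -> edge E -> R) :
  D_admissible (dual_scale S) eta kappa phi <->
  exists (mu : off_scale S -> R) (phip phim : V -> edge E -> R),
    (forall k a, phi k a = phip k a - phim k a) /\
    lp_dual_feasible (P_lp R E S) (P_mult eta mu phip phim kappa).
Proof.
pose net i j := \sum_(a | etgt a == i) phi j a - \sum_(a | esrc a == i) phi j a.
split=> [[le1 phi_le net_ge K_ge0] | [mu [phip [phim [phiE]]]]].
  pose phip k a := Num.max (phi k a) 0; pose phim k a := Num.max (- phi k a) 0.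
  have phiE k a : phi k a = phip k a - phim k a.
    by rewrite /phip /phim; case: (lerP (phi k a) 0) => ?;
      case: (lerP (- phi k a) 0) => ?; lra.
  exists (fun p => net (val p).1 (val p).2 - eta (val p).1), phip, phim.
  split=> //; apply/P_lp_dual_feasibleP; split=> // [k a|i j|].
  - have [? ?] := phi_le k a; have := K_ge0 a.
    by rewrite /phip /phim; case: (lerP (phi k a) 0) => ?;
      case: (lerP (- phi k a) 0) => ?; lra.
  - under eq_bigr do rewrite -phiE.
    under [X in _ - X]eq_bigr do rewrite -phiE.
    case: insubP => [p _ pE | in_scale] /=; first by rewrite pE addrC subrK.
    by rewrite addr0; apply: net_ge; rewrite inE -[_ \in _]negbK.
  - by split=> // k a; rewrite le_max lexx orbT.
move/P_lp_dual_feasibleP => [le1 leK leeta [p_ge0 m_ge0 K_ge0]].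
split=> // [k a|k i].
  have := leK k a; have := p_ge0 k a; have := m_ge0 k a.
  by rewrite phiE => ? ? ?; split; lra.
rewrite inE => in_scale; have := leeta i k.
rewrite insubF ?in_scale // addr0.
under eq_bigr do rewrite -phiE.
by under [X in _ - X]eq_bigr do rewrite -phiE.
Qed.

Lemma PD_weak_duality x (ee : edge E -> V -> R) e (eta : V -> R)
    (kappa : edge E -> R) phi :
  P_admissible S x ee e -> D_admissible (dual_scale S) eta kappa phi ->
  \sum_i eta i <= e.
Proof.
move=> /P_admissibleP x_feas /D_admissibleP[mu [phip [phim [_ y_feas]]]].
have := lp_weak_duality x_feas y_feas.
by rewrite P_lp_value P_lp_dual_value.
Qed.

Lemma PD_strong_duality x0 (ee0 : edge E -> V -> R) e0 (z : R) :
  P_admissible S x0 ee0 e0 ->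
  (forall x (ee : edge E -> V -> R) e, P_admissible S x ee e -> z <= e) ->
  exists (eta : V -> R) (kappa : edge E -> R) phi,
    D_admissible (dual_scale S) eta kappa phi /\ z <= \sum_i eta i.
Proof.
move=> /P_admissibleP x0_feas z_le.
have [X|y y_feas] := lp_strong_duality (z := z) x0_feas.
  have [x [ee [e ->]]] := P_vec_surj X.
  by rewrite P_lp_value => /P_admissibleP; apply: z_le.
have [eta [mu [phip [phim [kappa yE]]]]] := P_mult_surj y.
rewrite yE P_lp_dual_value in y_feas * => z_le_eta.
exists eta, kappa, (fun k a => phip k a - phim k a); split=> //.
by apply/D_admissibleP; exists mu, phip, phim.
Qed.

(** Dirac measures at points [f i] of the scale are admissible.  Each [e_{ij,k}]
    may be taken to be [1], a crude bound whose sum over [k] is [#|V|]. *)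
Lemma P_admissible_inhabited :
  (forall i, exists j, j \in S i) ->
  exists (x : V -> V -> R) (ee : edge E -> V -> R) e, P_admissible S x ee e.
Proof.
move=> /choice[f fS].
exists (fun i j => (j == f i)%:R), (fun _ _ => 1), #|V|%:R.
split=> [i|i j|a k|a|].
- by under eq_bigr do rewrite -[_%:R]mulr1; rewrite sum_delta.
- by case: eqP => // -> /negP[].
- by case: (k == _); case: (k == _); split; rewrite /=; lra.
- by rewrite sumr_const.
- by split.
Qed.

(** No flow constraint mentions [eta i] when [S i] is empty, as [i] then belongs
    to no set of the dual scale. *)
Lemma D_unbounded (M : R) i :
  (forall j, j \notin S i) ->
  exists (eta : V -> R) (kappa : edge E -> R) phi,
    D_admissible (dual_scale S) eta kappa phi /\ \sum_j eta j = M.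
Proof.
move=> Si_empty; exists (fun j => (j == i)%:R * M), (fun=> 0), (fun _ _ => 0).
split; last exact: (sum_delta i (fun=> M)).
split=> [|k a|k j|//].
- by rewrite big1 ?ler01.
- by rewrite oppr0.
rewrite inE !big1 // subr0; case: eqP => [->|_ _]; last by rewrite mul0r.
by rewrite (negPf (Si_empty k)).
Qed.

End Duality.

Lemma PD_value (R : realType) (V : finType) (E : {set V * V}) (S : V -> {set V}) :
  P_value R E S = D_value R E (dual_scale S).
Proof.
apply/le_anti/andP; split; last first.
  apply: ge_ereal_sup => _ [eta [kappa [phi [D_adm ->]]]].
  apply: le_ereal_inf_tmp => _ [x [ee [e [P_adm ->]]]].
  by rewrite lee_fin; apply: PD_weak_duality P_adm D_adm.
have D_ge (eta : V -> R) (kappa : edge E -> R) phi :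
    D_admissible (dual_scale S) eta kappa phi ->
    ((\sum_i eta i)%:E <= D_value R E (dual_scale S))%E.
  by move=> D_adm; apply: ereal_sup_ubound; exists eta, kappa, phi.
have [S_inhab | /existsNP[i /forallNP Si_empty]] :=
  pselect (forall i, exists j, j \in S i); last first.
  suff -> : D_value R E (dual_scale S) = +oo%E by rewrite leey.
  apply: eq_infty => M.
  have [eta [kappa [phi [/D_ge D_adm <-]]]] :=
    D_unbounded E M (fun j => introN idP (Si_empty j)).
  exact: D_adm.
have [x0 [ee0 [e0 P_adm0]]] := P_admissible_inhabited R E S_inhab.
have P_le x (ee : edge E -> V -> R) e :
    P_admissible S x ee e -> (P_value R E S <= e%:E)%E.
  by move=> P_adm; apply: ereal_inf_lbound; exists x, ee, e.
have P_ge0 : (0 <= P_value R E S)%E.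
  by apply: le_ereal_inf_tmp => _ [x [ee [e [[_ _ _ _ [_ _ e_ge0]] ->]]]].
have P_fin : P_value R E S \is a fin_num.
  by rewrite ge0_fin_numE // (le_lt_trans (P_le _ _ _ P_adm0)) ?ltry.
have [x ee e /P_le|eta [kappa [phi [/D_ge D_adm z_le]]]] :=
    PD_strong_duality (z := fine (P_value R E S)) P_adm0.
  by rewrite -{1}(fineK P_fin) lee_fin.
by rewrite -(fineK P_fin); apply: le_trans D_adm; rewrite lee_fin.
Qed.

Theorem theorem3p2 (R : realType) (V : finType) (E : {set V * V})
    (E_noloop : forall i : V, (i, i) \notin E) (S : V -> {set V}) :
  [/\
    (* P_lp is (P) *)
    (forall (x : V -> V -> R) (ee : edge E -> V -> R) (e : R),
       (P_admissible S x ee e <-> lp_feasible (P_lp R E S) (P_vec x ee e)) /\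
       lp_value (P_lp R E S) (P_vec x ee e) = e),
    (* (D) is the linear-programming dual of P_lp, after substituting
       phi := phip - phim and eliminating mu *)
    (forall (eta : V -> R) (kappa : edge E -> R) (phi : V -> edge E -> R),
       D_admissible (dual_scale S) eta kappa phi <->
       exists (mu : off_scale S -> R) (phip phim : V -> edge E -> R),
         (forall k a, phi k a = phip k a - phim k a) /\
         lp_dual_feasible (P_lp R E S) (P_mult eta mu phip phim kappa)),
    (forall (eta : V -> R) (mu : off_scale S -> R)
        (phip phim : V -> edge E -> R) (kappa : edge E -> R),
       lp_dual_value (P_lp R E S) (P_mult eta mu phip phim kappa) = \sum_i eta i),
    (* weak duality *)
    (forall (x : V -> V -> R) (ee : edge E -> V -> R) (e : R)
        (eta : V -> R) (kappa : edge E -> R) (phi : V -> edge E -> R),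
       P_admissible S x ee e ->
       D_admissible (dual_scale S) eta kappa phi ->
       \sum_i eta i <= e)
    (* strong duality *)
    & P_value R E S = D_value R E (dual_scale S)].
Proof.
split; first by split; [apply: P_admissibleP | apply: P_lp_value].
- exact: D_admissibleP.
- exact: P_lp_dual_value.
- exact: PD_weak_duality.
- exact: PD_value.
Qed.
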